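(* Let $q$ be a prime power, let $d\ge 2$ and $m$ be integers with $2d\le m$, and let $C\le \mathbb{F}_{q^m}^{2d}$ be an $\mathbb{F}_{q^m}$-linear $[2d,d,d]$ rank metric code (length $2d$, $\mathbb{F}_{q^m}$-dimension $d$, minimum rank distance $d$) which is dually AMRD and satisfies $A_{d+1}(C)=0$. Then $d+1$ is a prime.
   Context: The field $\mathbb{F}_{q^m}$ is regarded as an $m$-dimensional vector space over $\mathbb{F}_q$. The rank weight of $v=(v_1,\dots,v_n)\in\mathbb{F}_{q^m}^n$ is $\mathrm{wt}(v)=\dim_{\mathbb{F}_q}\langle v_1,\dots,v_n\rangle_{\mathbb{F}_q}$, and the rank distance between $u$ and $v$ is $\mathrm{wt}(u-v)$. An $[n,k,\delta]$ $\mathbb{F}_{q^m}$-linear rank metric code is a $k$-dimensional $\mathbb{F}_{q^m}$-subspace $C\le\mathbb{F}_{q^m}^n$ with minimum distance $\delta=\min\{\mathrm{wt}(c)\mid 0\ne c\in C\}$; here $n\le m$ is assumed. $A_i(C)$ denotes the number of codewords of $C$ of rank weight $i$. The rank defect of an $[n,k,\delta]$ code is $\mathrm{def}(C)=n-k+1-\delta$. $C^\perp$ is the orthogonal of $C$ with respect to the standard inner product of $\mathbb{F}_{q^m}^n$. $C$ is called dually AMRD (dually almost MRD) if $\mathrm{def}(C)=\mathrm{def}(C^\perp)=1$. *)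

(* Defs.v *)
From HB Require Import structures.
From mathcomp Require Import all_boot all_order all_algebra all_field.

Set Implicit Arguments.
Unset Strict Implicit.
Unset Printing Implicit Defensive.

Import Order.TTheory GRing.Theory Num.Theory.

Section RankMetricCodes.

(* [F] is F_q and [L] is F_(q^m), with m the dimension of [{:L}] over [F].
   [L] carries no canonical finType structure; its alias [finvect_type L] does,
   and is used below wherever a finite enumeration of vectors is needed. *)
Variables (F : finFieldType) (L : fieldExtType F) (n : nat).

Definition rank_weight (v : 'rV[L]_n) : nat :=
  \dim <<[seq v ord0 i | i : 'I_n]>>%VS.

Definition num_codewords (C : {vspace 'rV[L]_n}) (i : nat) : nat :=
  #|[set c : 'rV[finvect_type L]_n |
      ((c : 'rV[L]_n) \in C) && (rank_weight c == i)]|.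

(* All rank weights are at most [n], so the default value [n.+1] is only taken
   by the zero code, which has no minimum distance. *)
Definition min_rank_dist (C : {vspace 'rV[L]_n}) : nat :=
  \big[minn/n.+1]_(c : 'rV[finvect_type L]_n |
      ((c : 'rV[L]_n) \in C) && (c != 0%R)) rank_weight c.

Definition is_rank_code (k delta : nat) (C : {vspace 'rV[L]_n}) : Prop :=
  \dim C = k /\ min_rank_dist C = delta.

Definition dual_code (C : {vspace 'rV[L]_n}) : {vspace 'rV[L]_n} :=
  (\bigcap_(c : 'rV[finvect_type L]_n | (c : 'rV[L]_n) \in C)
     lker (linfun (mulmxr (c : 'rV[L]_n)^T : 'rV[L]_n -> 'M[L]_1)))%VS.

Definition rank_defect (C : {vspace 'rV[L]_n}) : int :=
  (n%:Z - (\dim C)%:Z + 1 - (min_rank_dist C)%:Z)%R.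

Definition dually_AMRD (C : {vspace 'rV[L]_n}) : Prop :=
  rank_defect C = 1%R /\ rank_defect (dual_code C) = 1%R.

Lemma mem_dual_code (C : {vspace 'rV[L]_n}) (v : 'rV[L]_n) :
  v \in dual_code C <->
  (forall c : 'rV[L]_n, c \in C ->
     (\sum_(i < n) v ord0 i * c ord0 i = 0)%R).
Proof.
have dotE (c : 'rV[L]_n) :
    (v *m c^T)%R = (\sum_(i < n) v ord0 i * c ord0 i)%:M%R.
  apply/matrixP=> i j; rewrite !ord1 !mxE eqxx mulr1n.
  by apply: eq_bigr => k _; rewrite mxE.
have kerE (c : 'rV[L]_n) :
    (v \in lker (linfun (mulmxr c^T : 'rV[L]_n -> 'M[L]_1))) =
    ((\sum_(i < n) v ord0 i * c ord0 i)%R == 0%R).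
  rewrite memv_ker lfunE /= dotE; apply/eqP/eqP => [/matrixP/(_ ord0 ord0)|->].
    by rewrite !mxE eqxx mulr1n.
  by rewrite raddf0.
rewrite memvE; split=> [/subv_bigcapP vC c cC | vC].
  by apply/eqP; rewrite -kerE memvE; apply: (vC c).
by apply/subv_bigcapP => c cC; rewrite -memvE kerE; apply/eqP/vC.
Qed.

Lemma rank_weight_le (v : 'rV[L]_n) : rank_weight v <= n.
Proof.
by apply: leq_trans (dim_span _) _; rewrite size_map size_enum_ord.
Qed.

Lemma min_rank_distP (C : {vspace 'rV[L]_n}) (delta : nat) : C != 0%VS ->
  min_rank_dist C = delta <->
  ((exists c : 'rV[L]_n, [/\ c \in C, c != 0%R & rank_weight c = delta]) /\
   (forall c : 'rV[L]_n, c \in C -> c != 0%R -> delta <= rank_weight c)).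
Proof.
move=> C0.
have lb (c : 'rV[L]_n) : c \in C -> c != 0%R -> min_rank_dist C <= rank_weight c.
  move=> cC c0; rewrite /min_rank_dist.
  by apply: (@bigmin_le_cond _ nat 'rV[finvect_type L]_n n.+1 c); rewrite cC.
have [c [cC c0 wc]] :
    exists c : 'rV[L]_n, [/\ c \in C, c != 0%R & rank_weight c = min_rank_dist C].
  have : min_rank_dist C = n.+1 \/
    exists c : 'rV[L]_n, [/\ c \in C, c != 0%R & rank_weight c = min_rank_dist C].
    rewrite /min_rank_dist; elim/big_ind: _; first by left.
      by move=> x y hx hy; rewrite /minn; case: ifP.
    by move=> c /andP[cC c0]; right; exists c.
  case=> // E; exfalso.
  have := lb (vpick C) (memv_pick C); rewrite vpick0 E => /(_ C0).
  by rewrite ltnNge rank_weight_le.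
split=> [<-|[[x [xC x0 <-]] h]]; first by split=> //; exists c.
by apply/eqP; rewrite eqn_leq lb //= -wc h.
Qed.

End RankMetricCodes.

(* Main.v *)
Require Import Defs.
From mathcomp Require Import all_boot all_order all_algebra all_field.
From HB Require Import structures.
From mathcomp Require Import zify.

Set Implicit Arguments.
Unset Strict Implicit.
Unset Printing Implicit Defensive.
Import GRing.Theory.

(** A code satisfying the hypotheses yields a q-Steiner system S_q(d-1, d, 2d),
    and the classical divisibility conditions for such a design force d + 1 to
    be prime.

    To a codeword c attach the F-space [orth c] of all l in F^(2d) with
    sum_i l_i c_i = 0, the orthogonal of the rank support of c; its dimension
    is 2d - wt(c) ([dim_orth]). The blocks are the spaces [orth c] for the
    codewords c of weight d, so that they have dimension d. Take d - 1
    F-independent vectors t_1, ..., t_(d-1) of F^(2d). Killing them imposes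
    d - 1 linear conditions on the d-dimensional code C, and these conditions
    are independent: an L-linear relation among them is a nonzero word
    sum_j y_j t_j of the dual code, of weight at most d - 1, while the dual
    code has minimum distance d. Hence the codewords c whose [orth c] contains
    all the t_j form a line over L ([codeword_orth_line]). A generator of that
    line has weight at most d + 1, at least d, and not d + 1 since
    A_(d+1)(C) = 0; so the t_j lie in exactly one block.

    Suppose now that d + 1 is composite and let p <= d be a prime divisor of it.
    Fix d - p independent vectors s. The tuples of p - 1 vectors extending s to
    an independent family are partitioned by the block containing them, and
    all classes have the same size, a function of q, d and p. Thus
    ([steiner_dvd]), with i ranging over 0, ..., p - 2,
      prod_i (q^d - q^(d-p+i))  divides  prod_i (q^(2d) - q^(d-p+i)).
    After removal of the powers of q and of q - 1, the q-integer [p]_q divides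
    [d+2]_q ... [d+p]_q. But p divides d + 1, hence is coprime to each of
    d + 2, ..., d + p, and q-integers of coprime indices are coprime: so
    [p]_q = 1, which is absurd ([steiner_arith]). *)

(** * Divisibility of q-integers *)

Definition qint (q n : nat) : nat := \sum_(i < n) q ^ i.

Lemma subn1_qint (q n : nat) : 0 < q -> q ^ n - 1 = (q - 1) * qint q n.
Proof. by move=> q0; rewrite !subn1 predn_exp. Qed.

Lemma qintD (q a b : nat) : qint q (a + b) = qint q a + q ^ a * qint q b.
Proof.
rewrite /qint big_split_ord /= big_distrr /=; congr (_ + _).
by apply: eq_bigr => i _; rewrite expnD.
Qed.

Lemma qint_dvd_mul (q a u : nat) : qint q a %| qint q (u * a).
Proof.
elim: u => [|u IH]; first by rewrite mul0n /qint big_ord0 dvdn0.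
by rewrite mulSn qintD dvdn_add ?dvdn_mull.
Qed.

(** A Bezout relation u a = 1 + v b gives [ua]_q = 1 + q [vb]_q, where [a]_q
    divides [ua]_q and [b]_q divides [vb]_q: a common divisor of [a]_q and [b]_q
    divides 1. *)
Lemma coprime_qint (q a b : nat) :
  0 < a -> coprime a b -> coprime (qint q a) (qint q b).
Proof.
move=> a0 /eqP cab; case: (egcdnP b a0) => u v; rewrite cab => uv _.
set g := gcdn (qint q a) (qint q b).
have ga : g %| qint q (u * a) by rewrite (dvdn_trans (dvdn_gcdl _ _)) ?qint_dvd_mul.
have gb : g %| qint q (v * b) by rewrite (dvdn_trans (dvdn_gcdr _ _)) ?qint_dvd_mul.
rewrite /coprime -/g -dvdn1; move: ga.
rewrite uv addnC qintD {1}/qint big_ord_recl big_ord0 expn0 addn0.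
by rewrite dvdn_addl // dvdn_mull.
Qed.

Lemma qint_gt1 (q n : nat) : 0 < q -> 1 < n -> 1 < qint q n.
Proof.
move=> q0; case: n => [|[|n]] // _.
rewrite -[n.+2]add1n -[n.+1]add1n !qintD.
have -> : qint q 1 = 1 by rewrite /qint big_ord1 expn0.
by rewrite -[X in X < _]addn0 ltn_add2l muln_gt0 expn_gt0 q0.
Qed.

Lemma coprime_prodr_ord (a k : nat) (f : 'I_k -> nat) :
  (forall i, coprime a (f i)) -> coprime a (\prod_(i < k) f i).
Proof.
move=> cop; elim/big_ind: _ => // [|x y hx hy]; first exact: coprimen1.
by rewrite coprimeMr hx hy.
Qed.

(** The failure of the divisibility condition for S_q(d-1, d, 2d) at a prime
    p <= d dividing d + 1. Writing q^N - q^e = q^e (q - 1) [N - e]_q makes the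
    powers of q and of q - 1 cancel on both sides; the factor i = 0 of the
    divisor leaves [p]_q, which is coprime to all the factors [d + p - i]_q of
    the dividend because 0 < p - 1 - i < p. *)
Lemma steiner_arith (q d p : nat) : 1 < q -> prime p -> p %| d.+1 -> p <= d ->
  ~~ (\prod_(i < p.-1) (q ^ d - q ^ (d - p + i)) %|
      \prod_(i < p.-1) (q ^ (2 * d) - q ^ (d - p + i))).
Proof.
move=> q1 pp pd pled; have q0 : 0 < q by apply: ltnW.
have p1 := prime_gt1 pp.
have fac N (i : 'I_p.-1) : d <= N ->
  q ^ N - q ^ (d - p + i) =
    (q ^ (d - p + i) * (q - 1)) * qint q (N - (d - p + i)).
  move=> dN; have lei : d - p + i <= N.
    have := ltn_ord i; move: (val i) => j; case: (p) p1 pled => // p' _ ? ?.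
    apply: leq_trans dN; rewrite -[leqRHS](@subnK p'.+1) // leq_add2l.
    by apply: ltnW; apply: ltn_trans (ltnSn _).
  by rewrite -mulnA -subn1_qint // mulnBr muln1 -expnD subnKC.
under eq_bigr => i _ do rewrite fac //.
under [X in _ %| X]eq_bigr => i _ do rewrite fac ?leq_pmull //.
rewrite !big_split /= dvdn_pmul2l; last first.
  by rewrite muln_gt0 !prodn_gt0 // => i; rewrite ?expn_gt0 ?q0 ?subn_gt0.
apply/negP => dv.
have i0 : 0 < p.-1 by rewrite -subn1 subn_gt0.
have {dv} : qint q p %| \prod_(i < p.-1) qint q (2 * d - (d - p + i)).
  apply: dvdn_trans dv; rewrite (bigD1 (Ordinal i0)) //= addn0 subKn //.
  exact: dvdn_mulr.
have cop : coprime (qint q p) (\prod_(i < p.-1) qint q (2 * d - (d - p + i))).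
  apply: coprime_prodr_ord => i; apply: coprime_qint; first exact: ltnW.
  rewrite prime_coprime //.
  have ip : i < p.-1 by [].
  have -> : 2 * d - (d - p + i) = d.+1 + (p.-1 - i).
    apply/eqP; rewrite -(eqn_add2r (d - p + i)) subnK; last first.
      rewrite mul2n -addnn leq_add ?leq_subr //.
      by apply: ltnW; apply: leq_trans ip _; apply: leq_trans pled; apply: leq_pred.
    rewrite [d - p + i]addnC addnA -[_ + i]addnA subnK; last exact: ltnW.
    by rewrite addSnnS prednK ?(ltnW p1) // -addnA subnKC // mul2n addnn.
  rewrite dvdn_addr // gtnNdvd ?subn_gt0 //.
  by apply: leq_ltn_trans (leq_subr _ _) _; rewrite prednK // ltnW.
move=> /gcdn_idPl; rewrite (eqP cop) => E.
by have := qint_gt1 q0 p1; rewrite -E.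
Qed.

(** * Counting in q-Steiner systems *)

Section Counting.
Variables (F : finFieldType) (n : nat).
Local Notation E := 'rV[F]_n.
Local Notation q := #|F|.

(** Given i vectors already added, the next one ranges over X minus a span of
    dimension size s + i. The vectors are added in front, so that [free_cons]
    applies and s stays fixed in the induction. *)
Lemma card_free_extensions (X : {vspace E}) (s : seq E) (k : nat) :
  free s -> {subset s <= X} ->
  #|[set t : k.-tuple E | free (t ++ s) && all (mem X) t]| =
    \prod_(i < k) (q ^ \dim X - q ^ (size s + i)).
Proof.
move=> fs sX; elim: k => [|k IH].
  rewrite big_ord0; apply: (@eq_card1 _ [tuple]) => t.
  by rewrite tuple0 !inE /= fs eqxx.
rewrite big_ord_recr /= -IH -sum_nat_const -sum1_card.
rewrite (reindex (fun u : E * k.-tuple E => [tuple of u.1 :: u.2])) /=; last first.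
  exists (fun t => (thead t, [tuple of behead t])) => [[e t] _|t _] /=.
    by congr pair; apply: val_inj.
  by rewrite -tuple_eta.
transitivity (\sum_(u : E * k.-tuple E |
  (u.2 \in [set t : k.-tuple E | free (t ++ s) && all (mem X) t]) &&
  (u.1 \in [predD X & <<u.2 ++ s>>%VS])) 1).
  apply: eq_bigl => -[e t]; rewrite !inE /= free_cons.
  by case: (e \in X); case: (e \in <<_>>%VS); case: (free _); case: (all _ _).
rewrite (reindex (fun u : k.-tuple E * E => (u.2, u.1))) /=; last first.
  by exists (fun u : E * k.-tuple E => (u.2, u.1)) => -[].
rewrite -(pair_big_dep
  (fun t => t \in [set t : k.-tuple E | free (t ++ s) && all (mem X) t])
  (fun t e => e \in [predD X & <<t ++ s>>%VS]) (fun _ _ => 1)) /=.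
apply: eq_bigr => t; rewrite inE => /andP[ft /allP tX].
rewrite sum1_card.
have sub : (<<t ++ s>> <= X)%VS.
  by apply/span_subvP => x; rewrite mem_cat => /orP[/tX|/sX].
have := cardID <<t ++ s>>%VS X.
have -> : #|[predI X & <<t ++ s>>%VS]| = q ^ (size s + k).
  rewrite -[in RHS](size_tuple t) addnC -size_cat -(eqP ft) -card_vspace.
  by apply: eq_card => x; rewrite !inE andb_idl // => /(subvP sub).
by rewrite card_vspace => <-; rewrite addKn.
Qed.

(** The divisibility condition on a q-Steiner system S_q(k + j, r, n) with block
    set B, derived at a subspace of dimension j: the extensions of a fixed free
    family s of size j by k vectors are partitioned by the block that contains
    them, and [card_free_extensions] gives every class the same size. *)
Lemma steiner_dvd (B : pred {vspace E}) (j k r : nat) :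
  (forall X, B X -> \dim X = r) ->
  (forall t, free t -> size t = k + j -> exists2 X, B X & {subset t <= X}) ->
  (forall t X Y, free t -> size t = k + j -> B X -> B Y ->
     {subset t <= X} -> {subset t <= Y} -> X = Y) ->
  j <= n ->
  \prod_(i < k) (q ^ r - q ^ (j + i)) %| \prod_(i < k) (q ^ n - q ^ (j + i)).
Proof.
move=> dimB exB uniqB jn.
have [s fs ss] : exists2 s : seq E, free s & size s = j.
  have bF := basis_free (vbasisP {:E}); exists (take j (vbasis {:E})).
    by apply: (@catl_free _ _ (drop j (vbasis {:E}))); rewrite cat_take_drop.
  by rewrite size_takel // size_tuple dimvf /dim /= mul1n.
have := @card_free_extensions fullv s k fs (fun x _ => memvf x).
rewrite dimvf /dim /= mul1n ss => <-.
set D := finset _.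
have Dfree t : t \in D -> free (t ++ s) by rewrite inE => /andP[].
have szD (t : k.-tuple E) : size (t ++ s) = k + j by rewrite size_cat size_tuple ss.
have /fin_all_exists[blk blkP] (t : k.-tuple E) : exists X, t \in D ->
    [/\ B X, {subset t <= X} & {subset s <= X}].
  have [tD|tD] := boolP (t \in D); last by exists fullv.
  have [X BX tX] := exB _ (Dfree _ tD) (szD t); exists X => _; split=> // x xt;
    by apply: tX; rewrite mem_cat xt ?orbT.
(* Classes are labelled by the underlying sets of the blocks, which form a
   finite type. *)
pose f (t : k.-tuple E) := [set x | x \in blk t].
rewrite -[X in _ %| X]sum1_card (partition_big f predT) //=.
apply: dvdn_sum => Y _.
have [/existsP[t /andP[tD /eqP <-]]|/existsPn none] :=
  boolP [exists t : k.-tuple E, (t \in D) && (f t == Y)]; last first.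
  by rewrite [X in _ %| X]big1 // => t /andP[tD ft]; have := none t; rewrite tD ft.
have [BX tX sX] := blkP _ tD.
rewrite -(dimB _ BX) -ss -(card_free_extensions k fs sX) -[X in X %| _]sum1_card.
set N := (X in X %| _); rewrite (_ : \sum_(u in D | f u == f t) 1 = N) //.
apply: eq_bigl => u; rewrite !inE; have [fu|] //= := boolP (free (u ++ s)).
have uD : u \in D by rewrite inE fu; apply/allP => x _; apply: memvf.
have [BY uY sY] := blkP _ uD.
have -> /= : all (mem fullv) u by apply/allP => x _; apply: memvf.
apply/eqP/allP => [/setP e x /uY|uX]; first by have := e x; rewrite !inE => ->.
rewrite /f (uniqB (u ++ s) (blk u) (blk t)) // => x; rewrite mem_cat.
  by case/orP => [/uY|/sY].
by case/orP => [/uX|/sX].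
Qed.
End Counting.

(** * Generator matrices *)

Section Generator.
Variables (K : fieldType) (n : nat).
Local Open Scope ring_scope.

Lemma row_free_of_free k (X : k.-tuple 'rV[K]_n) :
  free X -> row_free (\matrix_(i < k) X`_i).
Proof.
move=> /freeP fX; apply: inj_row_free => v; rewrite mulmx_sum_row => v0.
by apply/rowP => i; rewrite mxE; apply: fX; rewrite -[RHS]v0; apply: eq_bigr => j _;
   rewrite rowK.
Qed.

Lemma generator_matrix (U : {vspace 'rV[K]_n}) :
  exists2 G : 'M[K]_(\dim U, n), row_free G & forall c, (c \in U) = (c <= G)%MS.
Proof.
exists (\matrix_(i < \dim U) (vbasis U)`_i).
  by apply: row_free_of_free; apply: basis_free (vbasisP U).
move=> c; apply/idP/submxP => [/coord_vbasis ->|[x ->]].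
  exists (\row_i coord (vbasis U) i c); rewrite mulmx_sum_row.
  by apply: eq_bigr => i _; rewrite mxE rowK.
rewrite mulmx_sum_row; apply: rpred_sum => i _; rewrite rowK rpredZ //.
by apply: vbasis_mem; apply: mem_nth; rewrite size_tuple.
Qed.

End Generator.

(** * Rank supports and the dual code *)

Section Codes.
Variables (F : finFieldType) (L : fieldExtType F) (n : nat).
Local Open Scope ring_scope.

Definition pairing (c : 'rV[L]_n) (l : 'rV[F]_n) : L :=
  \sum_(i < n) l ord0 i *: c ord0 i.

Fact pairing_is_linear c : linear (pairing c).
Proof.
move=> a u v; rewrite /pairing scaler_sumr -big_split; apply: eq_bigr => i _.
by rewrite !mxE scalerDl scalerA.
Qed.

HB.instance Definition _ c :=
  GRing.isLinear.Build F 'rV[F]_n L *:%R (pairing c) (pairing_is_linear c).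

(** The orthogonal, in F^n, of the rank support of c. *)
Definition orth (c : 'rV[L]_n) : {vspace 'rV[F]_n} := lker (linfun (pairing c)).

Lemma mem_orth c l : (l \in orth c) = (pairing c l == 0).
Proof. by rewrite memv_ker lfunE. Qed.

(** Rank-nullity: the image of [pairing c] is the F-span of the entries of c. *)
Lemma dim_orth c : (\dim (orth c) + rank_weight c)%N = n.
Proof.
have := limg_ker_dim (linfun (pairing c)) fullv.
rewrite capfv dimvf /dim /= mul1n; apply: etrans; congr (_ + \dim _)%N.
apply/eqP; rewrite eqEsubv; apply/andP; split.
  apply/span_subvP => _ /mapP[i _ ->].
  have -> : c ord0 i = linfun (pairing c) (delta_mx 0 i).
    rewrite lfunE /= /pairing (bigD1 i) //= mxE !eqxx scale1r big1 ?addr0 // => j ji.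
    by rewrite mxE (negbTE ji) andbF scale0r.
  by apply: memv_img; apply: memvf.
apply/subvP => _ /memv_imgP[l _ ->]; rewrite lfunE /=.
by apply: rpred_sum => i _; rewrite rpredZ // memv_span // map_f // mem_enum.
Qed.

Lemma orthZ (a : L) c : a != 0 -> orth (a *: c) = orth c.
Proof.
move=> a0; apply/vspaceP => l; rewrite !mem_orth.
have -> : pairing (a *: c) l = a * pairing c l.
  by rewrite mulr_sumr; apply: eq_bigr => i _; rewrite mxE scalerAr.
by rewrite mulf_eq0 (negbTE a0).
Qed.

Lemma orth_row_mx c k (T : 'M[F]_(k, n)) :
  (forall i, row i T \in orth c) <-> c *m (map_mx (in_alg L) T)^T = 0.
Proof.
have E i : (c *m (map_mx (in_alg L) T)^T) ord0 i = pairing c (row i T).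
  by rewrite !mxE; apply: eq_bigr => j _; rewrite !mxE mulr_algr.
split=> [Tc|/rowP cT i]; last by rewrite mem_orth -E cT mxE.
by apply/rowP => i; rewrite E mxE; apply/eqP; rewrite -mem_orth.
Qed.

(** The entries of an L-combination of k vectors over F are F-combinations of
    the k coefficients. *)
Lemma rank_weight_comb k (y : 'rV[L]_k) (T : 'M[F]_(k, n)) :
  (rank_weight (y *m map_mx (in_alg L) T) <= k)%N.
Proof.
rewrite /rank_weight; apply: (@leq_trans (\dim <<[seq y ord0 j | j : 'I_k]>>)).
  apply: dimvS; apply/span_subvP => _ /mapP[i _ ->]; rewrite mxE.
  apply: rpred_sum => j _; rewrite mxE mulr_algr rpredZ //.
  by rewrite memv_span // map_f // mem_enum.
by apply: leq_trans (dim_span _) _; rewrite size_map size_enum_ord.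
Qed.

Lemma dim_dual_code (C : {vspace 'rV[L]_n}) : (\dim C + \dim (dual_code C) <= n)%N.
Proof.
have [G fG memG] := generator_matrix C.
have [H fH memH] := generator_matrix (dual_code C).
have GH : G *m H^T = 0.
  apply/matrixP => i j; rewrite !mxE.
  have := (mem_dual_code C (row j H)).1.
  rewrite memH row_sub => /(_ isT (row i G)).
  rewrite memG row_sub => /(_ isT) E; rewrite -[RHS]E.
  by apply: eq_bigr => l _; rewrite !mxE mulrC.
by have := mulmx0_rank_max GH; rewrite mxrank_tr (eqP fG) (eqP fH).
Qed.

(** The vanishing of c' = x G on the rows of T is the system x A = 0 with
    A = G T^T. A vector y in the kernel on the other side, y A^T = 0, makes y T a
    word of the dual code, of weight at most k by [rank_weight_comb] and thus
    zero. So A has rank k and the solutions x form a line. *)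
Lemma codeword_orth_line (C : {vspace 'rV[L]_n}) k (T : 'M[F]_(k, n)) :
    \dim C = k.+1 -> row_free T ->
    (forall v, v \in dual_code C -> v != 0 -> (k < rank_weight v)%N) ->
  exists2 c, c \in C /\ c != 0 &
  forall c', c' \in C -> (forall i, row i T \in orth c') <-> exists a, c' = a *: c.
Proof.
move=> dimC freeT dualC.
have [G fG memG] := generator_matrix C.
pose A := G *m (map_mx (in_alg L) T)^T.
have rA : \rank A = k.
  rewrite -mxrank_tr; apply/eqP/inj_row_free => y yA; apply/eqP; apply: contraT => y0.
  have v0 : y *m map_mx (in_alg L) T != 0.
    by rewrite mulmx_free_eq0 // row_free_map.
  have := dualC _ _ v0; rewrite ltnNge rank_weight_comb; apply.
  apply/mem_dual_code => c; rewrite memG => /submxP[x ->].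
  have /matrixP/(_ 0 0) : y *m map_mx (in_alg L) T *m (x *m G)^T = 0.
    rewrite trmx_mul mulmxA -(mulmxA y) -[map_mx _ _]trmxK -trmx_mul yA.
    by rewrite mul0mx.
  rewrite [LHS]mxE [RHS]mxE => E; rewrite -[RHS]E.
  by apply: eq_bigr => i _; rewrite [_^T _ _]mxE.
have rK : \rank (kermx A) = 1%N by rewrite mxrank_ker rA dimC subSnn.
have /rowV0Pn[x xK x0] : kermx A != 0 by rewrite -mxrank_eq0 rK.
exists (x *m G); first by rewrite memG submxMl mulmx_free_eq0.
move=> c'; rewrite memG => /submxP[x' ->]; rewrite orth_row_mx.
have rx : \rank x = 1%N by rewrite rank_rV x0.
have Kx : (kermx A <= x)%MS by rewrite -(geq_leqif (mxrank_leqif_sup xK)) rK rx.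
rewrite -mulmxA -/A; split=> [x'A|[a]].
  have /sub_rVP[a ->] : (x' <= x)%MS by apply: submx_trans Kx; apply/sub_kermxP.
  by exists a; rewrite scalemxAl.
rewrite scalemxAl => /(row_free_inj fG) ->; apply/sub_kermxP.
exact: scalemx_sub.
Qed.

End Codes.

(** * Primality of d + 1 *)

Theorem theorem5p7 (F : finFieldType) (L : fieldExtType F) (d m : nat)
    (C : {vspace 'rV[L]_(2 * d)}) :
  2 <= d ->
  \dim {:L} = m ->
  2 * d <= m ->
  is_rank_code d d C ->
  dually_AMRD C ->
  num_codewords C d.+1 = 0 ->
  prime d.+1.
Proof.
move=> d2 _ _ [dimC distC] [_ defD] A0.
have d0 : 0 < d by apply: ltnW.
have C0 : C != 0%VS by rewrite -dimv_eq0 dimC -lt0n.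
have [_ wtC] := (min_rank_distP d C0).1 distC.
have wtC1 c : c \in C -> rank_weight c != d.+1.
  move=> cC; apply: contraTneq isT => wc.
  by have /setP/(_ c) := cards0_eq A0; rewrite !inE cC wc eqxx.
have wtD v : v \in dual_code C -> v != 0%R -> d.-1 < rank_weight v.
  move=> vD v0; rewrite prednK //.
  have D0 : dual_code C != 0%VS by apply: contraNneq v0 => D0; rewrite -memv0 -D0.
  have [_ /(_ v vD v0)] := (min_rank_distP _ D0).1 erefl.
  (* The dual code has distance 2d - dim C^perp, as its defect is 1. *)
  apply: leq_trans; have := dim_dual_code C; rewrite dimC.
  move: defD; rewrite /rank_defect; lia.
apply: contraT => npr.
have [p pp pd] : exists2 p, prime p & p %| d.+1.
  by exists (pdiv d.+1); rewrite ?pdiv_prime ?pdiv_dvd.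
have pled : p <= d.
  rewrite -ltnS ltn_neqAle dvdn_leq // andbT.
  by apply: contraNneq npr => <-.
have p1 := prime_gt1 pp.
have q1 : 1 < #|F| := card_finNzRing_gt1 F.
have /negP[] := steiner_arith q1 pp pd pled.
pose defines_block (X : {vspace 'rV[F]_(2 * d)}) (c : 'rV[finvect_type L]_(2 * d)) :=
  [&& (c : 'rV[L]_(2 * d)) \in C, c != 0%R & orth (c : 'rV[L]_(2 * d)) == X].
pose B X := (\dim X == d) && [exists c, defines_block X c].
(* A family of p - 1 + (d - p) = d - 1 free vectors fixes a codeword up to a scalar. *)
have szE : p.-1 + (d - p) = d.-1 by lia.
have line (t : seq 'rV[F]_(2 * d)) : free t -> size t = p.-1 + (d - p) ->
    exists2 c, c \in C /\ c != 0%R &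
    forall c', c' \in C -> {subset t <= orth c'} <-> exists a, c' = (a *: c)%R.
  rewrite szE => ft /eqP st; pose T := (\matrix_(i < d.-1) (Tuple st)`_i)%R.
  have fT : row_free T by apply: row_free_of_free.
  have [|c cC cP] := codeword_orth_line _ fT wtD; first by rewrite prednK.
  exists c => // c' c'C; rewrite -cP //; split=> [h i|h _ /(nthP 0%R)[i it <-]].
    by rewrite rowK; apply: h; apply: mem_nth; rewrite (eqP st).
  by move: it; rewrite (eqP st) => it; have := h (Ordinal it); rewrite rowK.
apply: (@steiner_dvd F (2 * d) B (d - p) p.-1 d) => [X /andP[/eqP]|t ft st|t X Y ft st|].
- by [].
- have [c [cC c0] cP] := line t ft st.
  have tc : {subset t <= orth c} by apply/cP => //; exists 1%R; rewrite scale1r.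
  exists (orth c) => //; apply/andP; split; last first.
    by apply/existsP; exists c; rewrite /defines_block cC c0 eqxx.
  (* [orth c] has dimension at least d - 1, so wt(c) <= d + 1. *)
  have wd := dim_orth c.
  have wlb := wtC _ cC c0; have wne := wtC1 _ cC.
  have : \dim <<t>> <= \dim (orth c) by apply: dimvS; apply/span_subvP.
  move: ft; rewrite /free => /eqP ->; rewrite st szE.
  by move: wd wlb wne => /=; lia.
- have [c [cC c0] cP] := line t ft st.
  have key Z : B Z -> {subset t <= Z} -> orth c = Z.
    move=> /andP[_ /existsP[c' /and3P[c'C c'0 /eqP <-]]] /cP[] // a ca.
    rewrite ca orthZ //; apply: contraNneq c'0 => a0.
    by rewrite ca a0 scale0r.
  by move=> BX BY tX tY; rewrite -(key X) // (key Y).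
- by lia.
Qed.
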